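(* Let $P$ be a fixed $(m_1,t_1)$-subspace of $R^{n+k}$ and let ${\cal M}'_R(m_1,t_1;m,t;n+k,n)$ be the set of all $(m,t)$-subspaces of $R^{n+k}$ containing $P$. Then this set is non-empty if and only if $$0\leq t_1\leq t\leq k\quad\text{and}\quad 0\leq m_1-t_1\leq m-t\leq n.$$ Moreover, if it is non-empty, its size $N'_R(m_1,t_1;m,t;n+k,n)$ does not depend on the choice of $P$ and $$N'_R(m_1,t_1;m,t;n+k,n)=|R|^{(k-t)(m-t-m_1+t_1)}N_R(m-t-m_1+t_1,n-m_1+t_1)N_R(t-t_1,k-t_1),$$ where $N_R(a,b)=\prod_{j=1}^{\ell}\prod_{i=0}^{a-1}\frac{|R_j|^{b-i}-|M_j|^{b-i}}{|R_j|^{a-i}-|M_j|^{a-i}}$ is the number of $a$-subspaces of $R^b$.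
   Context: $R$ is a finite commutative ring with identity $1\neq 0$, written as a direct product $R=R_1\times\cdots\times R_\ell$ of finite local rings $R_j$ with maximal ideals $M_j$. $R^{N}$ denotes row vectors of length $N$ over $R$. A set $\{\alpha_1,\dots,\alpha_m\}\subseteq R^N$ is unimodular if the matrix with rows $\alpha_i$ has a right inverse. An $m$-subspace of $R^N$ is an $R$-submodule having a basis of $m$ vectors forming a unimodular set; the $0$-subspace is $\{0\}$. Let $e_i$ be the $i$-th standard unit row vector of $R^{n+k}$ and $E=\langle e_{n+1},\dots,e_{n+k}\rangle$. An $m$-subspace $P$ of $R^{n+k}$ is an $(m,t)$-subspace if $P\cap E$ is a $t$-subspace. *)

(* Defs.v *)
From HB Require Import structures.
From mathcomp Require Import all_boot all_order all_algebra.
Set Implicit Arguments.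
Unset Strict Implicit.
Unset Printing Implicit Defensive.
Import GRing.Theory Num.Theory.
Local Open Scope ring_scope.

(* The library predicate [idealr_closed] includes properness (1 \notin I). *)
Definition maximal_ideal (A : finComNzRingType) (I : {set A}) : Prop :=
  idealr_closed I /\
  forall J : {set A}, idealr_closed J -> I \subset J -> J = I.

Definition local_ring_with (A : finComNzRingType) (M : {set A}) : Prop :=
  maximal_ideal M /\ forall I : {set A}, maximal_ideal I -> I = M.

(* Bijectivity of r |-> (pr_0 r, ..., pr_(l-1) r); since the pr_j are ring
   morphisms, it says that R is the direct product of the Rj. *)
Definition is_direct_product (R : finComNzRingType) (l : nat)
    (Rj : 'I_l -> finComNzRingType) (pr : forall j, {rmorphism R -> Rj j}) :
    Prop :=
  forall x : (forall j, Rj j), exists! r : R, forall j, pr j r = x j.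

Section Subspaces.
Variable R : finComNzRingType.

Definition unimodular (m N : nat) (A : 'M[R]_(m, N)) : bool :=
  [exists B : 'M[R]_(N, m), A *m B == 1%:M].

(* c *m A is the linear combination of the rows of A with coefficients c. *)
Definition row_span (m N : nat) (A : 'M[R]_(m, N)) : {set 'rV[R]_N} :=
  [set c *m A | c : 'rV[R]_m].

Definition row_indep (m N : nat) (A : 'M[R]_(m, N)) : bool :=
  [forall c : 'rV[R]_m, (c *m A == 0) ==> (c == 0)].

Definition submodule (N : nat) (P : {set 'rV[R]_N}) : bool :=
  (0 \in P) &&
  [forall a : R, forall u in P, forall v in P, a *: u + v \in P].

Lemma submoduleP (N : nat) (P : {set 'rV[R]_N}) :
  reflect (submod_closed P) (submodule P).
Proof.
apply: (iffP andP) => -[P0 H]; split=> //.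
  move=> a u v Pu Pv; move/forallP/(_ a)/forall_inP/(_ u Pu): H.
  by move/forall_inP; apply.
by apply/forallP=> a; apply/forall_inP=> u Pu; apply/forall_inP=> v; apply: H.
Qed.

Definition basis_of_rows (m N : nat) (P : {set 'rV[R]_N})
    (A : 'M[R]_(m, N)) : bool :=
  (P == row_span A) && row_indep A.

Definition subspace (N m : nat) (P : {set 'rV[R]_N}) : bool :=
  submodule P &&
  [exists A : 'M[R]_(m, N), basis_of_rows P A && unimodular A].

Definition Espace (n k : nat) : {set 'rV[R]_(n + k)} :=
  row_span (\matrix_(i < k) delta_mx 0 (rshift n i)).

Definition mt_subspace (n k m t : nat) (P : {set 'rV[R]_(n + k)}) : bool :=
  subspace m P && subspace t (P :&: Espace n k).

Definition mt_subspaces_above (n k m t : nat) (P : {set 'rV[R]_(n + k)}) :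
    {set {set 'rV[R]_(n + k)}} :=
  [set Q | mt_subspace m t Q & P \subset Q].

End Subspaces.

(* N_R(a, b). If b < a the factor i = b of the numerator vanishes, so the
   truncation of b - i for i > b is harmless. *)
Definition NR (l : nat) (Rj : 'I_l -> finComNzRingType)
    (M : forall j, {set Rj j}) (a b : nat) : rat :=
  \prod_(j < l) \prod_(i < a)
    ((#|Rj j|%:R ^+ (b - i) - #|M j|%:R ^+ (b - i)) /
     (#|Rj j|%:R ^+ (a - i) - #|M j|%:R ^+ (a - i))).

(* Main.v *)
Require Import Defs.
From HB Require Import structures.
From mathcomp Require Import all_boot all_order all_algebra.
From mathcomp Require Import ring zify.
Set Implicit Arguments.
Unset Strict Implicit.
Unset Printing Implicit Defensive.
Import GRing.Theory Num.Theory.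
Local Open Scope ring_scope.

(* The key point is that over a finite commutative ring a matrix with linearly
   independent rows is unimodular and completes to an invertible matrix, by
   column reduction; the pivot comes from the fact that every element has an
   idempotent power. Hence an (m,t)-subspace containing
   [P = row_span (block_mx S1 X1 0 T1)] is the row span of a frame
   [block_mx (col_mx S1 S') (col_mx X1 X') 0 (col_mx T1 T')] with independent
   diagonal blocks, and it is counted as the number of such frames divided by
   the number of frames with a given span. Both numbers reduce to powers of
   [#|R|] and to numbers of unimodular rows, and a row is unimodular iff each of
   its local components has an entry outside the maximal ideal. The number of
   [a]-subspaces of [R^b] is the case [n = 0], [P = 0]. *)

(** * Linear independence and unimodularity of rows over a finite commutative ring *)

Section FiniteRing.
Variable R : finComNzRingType.

(** By pigeonhole [x ^+ (i + d) = x ^+ i] for some [d > 0], so from exponent [i] on the powers are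
    [d]-periodic. The exponent [d * i.+1] is a multiple of [d] and at least [i], hence doubling it
    changes nothing. *)
Lemma expr_idempotent (x : R) : exists2 N, (0 < N)%N & x ^+ N * x ^+ N = x ^+ N.
Proof.
have [i [d d_gt0 xE]] : exists i, exists2 d, (0 < d)%N & x ^+ (i + d) = x ^+ i.
  pose f (i : 'I_#|R|.+1) := x ^+ i.
  have /injectivePn[i [j ij fij]] : ~~ injectiveb f.
    by apply/negP => /injectiveP/leq_card; rewrite card_ord ltnn.
  wlog lt_ij : i j ij fij / (i < j)%N.
    have := ij; rewrite neq_ltn => /orP[|lt_ji wl]; first by move=> ? /(_ i j); apply.
    by apply: (wl j i) => //; rewrite eq_sym.
  by exists i, (j - i)%N; rewrite ?subn_gt0 // subnKC 1?ltnW // [RHS]fij.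
have stable p q : (i <= p)%N -> x ^+ (p + d * q) = x ^+ p.
  move=> le_ip; elim: q => [|q IHq]; first by rewrite muln0 addn0.
  have le_iq : (i <= p + d * q)%N by rewrite (leq_trans le_ip) // leq_addr.
  by rewrite -[RHS]IHq mulnSr addnA -(subnK le_iq) -addnA exprD xE -exprD.
exists (d * i.+1)%N; first by rewrite muln_gt0 d_gt0.
by rewrite -exprD stable // (leq_trans (leqnSn i)) // leq_pmull.
Qed.

(* With [e] the idempotent power of [x], [z = 1 - e] works: [x] is invertible
   on [e R] and nilpotent on [(1 - e) R], so an annihilator [r] of [x + y z]
   lies in [(1 - e) R] and the last nonzero [x ^+ p * r] is killed by both. *)
Lemma common_annihilator (x y : R) : exists z, forall r, r != 0 ->
  (x + y * z) * r = 0 -> exists c, [/\ c * r != 0, x * (c * r) = 0 & y * (c * r) = 0].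
Proof.
have [N N_gt0 xN] := expr_idempotent x; set e := x ^+ N in xN.
exists (1 - e) => r r_neq0 zr.
have er : e * r = 0.
  have xer : x * (e * r) = 0.
    transitivity (e * ((x + y * (1 - e)) * r) - y * (e * r - e * e * r)); first by ring.
    by rewrite zr xN; ring.
  by rewrite -xN -mulrA {1}/e -(prednK N_gt0) exprSr -mulrA xer mulr0.
(* Since [e * r = 0], the factor [1 - e] fixes [r], so [x + y] itself kills [r]. *)
have xyr : (x + y) * r = 0 by rewrite -[RHS]zr -[RHS]addr0 -(mulr0 y) -er; ring.
case: (@ex_minnP (fun p => x ^+ p * r == 0)); first by exists N; apply/eqP.
case=> [|p] /eqP xp min_p; first by rewrite expr0 mul1r in xp; rewrite xp eqxx in r_neq0.
exists (x ^+ p); split.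
- by apply/negP => /min_p; rewrite ltnn.
- by rewrite mulrA -exprS.
- have := congr1 ( *%R (x ^+ p)) xyr; rewrite mulr0 => E.
  by rewrite -[RHS]E -[LHS]add0r -[X in X + _]xp exprS; ring.
Qed.

Lemma regular_invertible (x : R) : (forall r, x * r = 0 -> r = 0) -> exists y, x * y = 1.
Proof.
move=> x_reg; have inj : injective ( *%R x).
  by move=> a b ab; apply/eqP; rewrite -subr_eq0; apply/eqP/x_reg; rewrite mulrBr ab subrr.
by have /codomP[y ->] := injF_onto inj 1; exists y.
Qed.

Lemma row_indepP (m N : nat) (A : 'M[R]_(m, N)) :
  reflect (forall c : 'rV_m, c *m A = 0 -> c = 0) (row_indep A).
Proof.
apply: (iffP forallP) => [A_ind c cA | A_ind c].
  by have := A_ind c; rewrite cA eqxx => /eqP.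
by apply/implyP => /eqP/A_ind->.
Qed.

Lemma row_indep_mulmx (m N p : nat) (A : 'M[R]_(m, N)) (C : 'M[R]_(p, m)) :
  row_indep A -> row_indep (C *m A) = row_indep C.
Proof.
move=> /row_indepP A_ind; apply/row_indepP/row_indepP => C_ind c cC.
  by apply: C_ind; rewrite mulmxA cC mul0mx.
by apply/C_ind/A_ind; rewrite -mulmxA.
Qed.

Lemma mulmx_lcancel (m N p : nat) (A : 'M[R]_(m, N)) (C D : 'M[R]_(p, m)) :
  row_indep A -> C *m A = D *m A -> C = D.
Proof.
move=> /row_indepP A_ind CD; apply/row_matrixP => i; apply/eqP.
rewrite -subr_eq0 -raddfB; apply/eqP/A_ind.
by rewrite -row_mul mulmxBl CD subrr row0.
Qed.

Lemma unimodular_row_indep (m N : nat) (A : 'M[R]_(m, N)) : unimodular A -> row_indep A.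
Proof.
case/existsP=> B /eqP AB; apply/row_indepP=> c cA.
by rewrite -[c]mulmx1 -AB mulmxA cA mul0mx.
Qed.

(** Induction on the length of [w]: its first entry [y] is absorbed into [x] as [x + y * z]. The [z]
    of [common_annihilator] keeps the joint annihilator with the rest of [w] trivial. With [w] used
    up, a regular element is left, and it is invertible. *)
Lemma unit_entry (n : nat) (x : R) (w : 'rV[R]_n) :
  (forall r, x * r = 0 -> r *: w = 0 -> r = 0) ->
  exists (beta : 'cV[R]_n) (u : R), (x + (w *m beta) 0 0) * u = 1.
Proof.
elim: n x w => [|n IHn] x w.
  move=> reg; have [|u xu] := @regular_invertible x.
    by move=> r xr; apply: reg => //; apply: thinmx0.
  by exists 0, u; rewrite mulmx0 mxE addr0.
rewrite -[w](@hsubmxK _ 1 1 n); move: (@lsubmx _ 1 1 n w) (@rsubmx _ 1 1 n w) => y w' reg.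
have [z zP] := common_annihilator x (y 0 0).
have [r zr rw | beta [u bu]] := IHn (x + y 0 0 * z) w'.
  apply/eqP; apply: contraTT isT => r_neq0.
  have [c [/negP cr xcr ycr]] := zP r r_neq0 zr; case: cr; apply/eqP.
  suff: (c * r) *: row_mx y w' = 0 by apply: reg.
  rewrite scale_row_mx -[_ *: w']scalerA rw scaler0 [y]mx11_scalar scale_scalar_mx.
  by rewrite mulrC ycr raddf0 row_mx0.
exists (col_mx z%:M beta), u; rewrite -[RHS]bu; congr (_ * _).
have -> : row_mx y w' *m col_mx z%:M beta = z *: y + w' *m beta.
  by rewrite mul_row_col mul_mx_scalar.
by rewrite !mxE addrA [z * _]mulrC.
Qed.

Lemma row_normal_form (n : nat) (v : 'rV[R]_(1 + n)) : row_indep v ->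
  exists G H : 'M[R]_(1 + n), [/\ G *m H = 1%:M, H *m G = 1%:M & v *m G = row_mx 1%:M 0].
Proof.
rewrite -[v]hsubmxK; move: (lsubmx v) (rsubmx v) => x w /row_indepP v_ind.
have [r xr rw | beta [u bu]] := @unit_entry n (x 0 0) w.
  have /(congr1 (fun M : 'M_1 => M 0 0)) : r%:M = 0 :> 'M_1.
    apply: v_ind; rewrite mul_scalar_mx scale_row_mx rw [x]mx11_scalar.
    by rewrite scale_scalar_mx mulrC xr raddf0 row_mx0.
  by rewrite !mxE.
have xb : (x + w *m beta) *m u%:M = 1%:M.
  by rewrite [x + _]mx11_scalar -scalar_mxM !mxE; congr _%:M; rewrite -bu mxE.
(* [E beta] turns the first entry into the unit [x + w *m beta]; [U] scales it to 1 and clears [w].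
   [V] is the inverse of [U], and [E (- beta)] that of [E beta]. *)
pose E c : 'M[R]_(1 + n) := block_mx 1%:M 0 c 1%:M.
pose U : 'M[R]_(1 + n) := block_mx u%:M (- (u%:M *m w)) 0 1%:M.
pose V : 'M[R]_(1 + n) := block_mx (x + w *m beta) w 0 1%:M.
pose G := E beta *m U; pose H := V *m E (- beta).
have vG : row_mx x w *m G = row_mx 1%:M 0.
  rewrite mulmxA !mul_row_block !mulmx1 !mulmx0 addr0 add0r xb.
  by rewrite mulmxN mulmxA xb mul1mx addNr.
have UV : U *m V = 1%:M.
  rewrite mulmx_block !mulmx0 !mul0mx !mulmx1 !add0r !addr0 subrr (mulmx1C xb).
  by rewrite -scalar_mx_block.
have GH : G *m H = 1%:M.
  rewrite mulmxA -[G *m V]mulmxA UV mulmx1 mulmx_block.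
  by rewrite !mul0mx !mulmx0 !mulmx1 !mul1mx !add0r !addr0 subrr -scalar_mx_block.
by exists G, H; split=> //; apply: mulmx1C.
Qed.

(* Column operations turn the first row of [A] into the first unit vector. *)
Lemma row_indep_reduce (m n : nat) (A : 'M[R]_(1 + m, 1 + n)) : row_indep A ->
  exists G H : 'M[R]_(1 + n), [/\ G *m H = 1%:M, H *m G = 1%:M &
    exists c A', row_indep A' /\ A *m G = block_mx 1%:M 0 c A'].
Proof.
move=> A_ind; have [|G [H [GH HG vG]]] := @row_normal_form n (usubmx A).
  apply/row_indepP => c cA.
  have /eqP : row_mx c 0 = 0 :> 'rV[R]_(1 + m).
    by apply: (row_indepP _ A_ind); rewrite -[A]vsubmxK mul_row_col cA mul0mx addr0.
  by rewrite row_mx_eq0 => /andP[/eqP].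
exists G, H; split=> //; exists (lsubmx (dsubmx A *m G)), (rsubmx (dsubmx A *m G)).
have AG : A *m G = block_mx 1%:M 0 (lsubmx (dsubmx A *m G)) (rsubmx (dsubmx A *m G)).
  by rewrite block_mxEv -vG hsubmxK -mul_col_mx vsubmxK.
split=> //; have G_ind : row_indep G.
  by apply: unimodular_row_indep; apply/existsP; exists H; apply/eqP.
move: A_ind; rewrite -(row_indep_mulmx A G_ind) AG => /row_indepP AG_ind.
apply/row_indepP => c cA; set c0 := lsubmx _ in AG_ind.
(* The coefficient [- (c *m c0)] on the pivot row cancels the first column, so a relation of [A']
   becomes one of the whole matrix. *)
have /eqP : row_mx (- (c *m c0)) c = 0.
  by apply: AG_ind; rewrite mul_row_block mulmx1 mulmx0 addNr add0r cA row_mx0.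
by rewrite row_mx_eq0 => /andP[_ /eqP].
Qed.

Lemma row_indep_row_mx1 (a c : nat) : row_indep (row_mx 1%:M 0 : 'M[R]_(a, a + c)).
Proof.
apply/row_indepP => d; rewrite mul_mx_row mulmx1 => /eqP.
by rewrite row_mx_eq0 => /andP[/eqP].
Qed.

Lemma row_indep0 (N : nat) : row_indep (0 : 'M[R]_(0, N)).
Proof. by apply/row_indepP => c _; apply: thinmx0. Qed.

(** Independence makes [c |-> c *m A] injective, so [#|R| ^ m <= #|R| ^ n]. *)
Lemma row_indep_leq (m n : nat) (A : 'M[R]_(m, n)) : row_indep A -> (m <= n)%N.
Proof.
move=> /row_indepP A_ind; have inj : injective (fun c : 'rV[R]_m => c *m A).
  move=> c d /= cd; apply/eqP; rewrite -subr_eq0; apply/eqP/A_ind.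
  by rewrite mulmxBl cd subrr.
by have := leq_card _ inj; rewrite !card_mx !mul1n leq_exp2l // card_finNzRing_gt1.
Qed.

(** Induction through [row_indep_reduce]: a right inverse [K] of the smaller block [A'] gives one of
    the lower triangular block matrix, and [G] carries it back to [A]. *)
Lemma row_indep_unimodular (m n : nat) (A : 'M[R]_(m, n)) : row_indep A = unimodular A.
Proof.
apply/idP/idP; last exact: unimodular_row_indep.
elim: m n A => [|m IHm] n A A_ind.
  by apply/existsP; exists 0; rewrite [_ *m _]flatmx0 [1%:M]flatmx0.
case: n A A_ind => [|n] A A_ind.
  by have := row_indep_leq A_ind.
have [G [H [GH HG [c [A' [/IHm/existsP[K /eqP AK] AG]]]]]] := @row_indep_reduce m n A A_ind.
pose B : 'M_(1 + n, 1 + m) := block_mx 1%:M 0 (- (K *m c)) K.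
have AGB : (A : 'M_(1 + m, 1 + n)) *m (G *m B) = 1%:M.
  rewrite mulmxA AG mulmx_block !mul0mx !mulmx0 !mulmx1 addr0 add0r.
  by rewrite mulmxN mulmxA AK mul1mx subrr add0r -scalar_mx_block.
by apply/existsP; exists (G *m B); rewrite AGB.
Qed.

(** The completion [D'] of the reduced block, preceded by a zero pivot column, is carried back by
    [H]. The equation on [n] is a hypothesis so that no casts between matrix sizes arise. *)
Lemma row_indep_complete (m r n : nat) (A : 'M[R]_(m, n)) : n = (m + r)%N ->
  row_indep A -> exists D : 'M[R]_(r, n), row_indep (col_mx A D).
Proof.
elim: m n A => [|m IHm] n A.
  move=> nE A_ind; move: A A_ind; rewrite {}nE => A A_ind; exists 1%:M.
  apply/row_indepP=> c; rewrite -[c]hsubmxK mul_row_col mulmx1.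
  by rewrite [lsubmx c]thinmx0 mul0mx add0r => ->; rewrite row_mx0.
case: n A => // n A [nE] A_ind.
have [G [H [GH HG [c [A' [A'_ind AG]]]]]] := @row_indep_reduce m n A A_ind.
have [D' D'_ind] := IHm n A' nE A'_ind.
exists (row_mx (0 : 'cV_r) D' *m H : 'M_(r, 1 + n)); apply/row_indepP => d.
rewrite -[d]hsubmxK mul_row_col; move: (lsubmx d) (rsubmx d) => a b.
pose a1 := @lsubmx _ 1 1 m a; pose a2 := @rsubmx _ 1 1 m a.
have aE : a = row_mx a1 a2 :> 'rV_(1 + m) by rewrite hsubmxK.
have aAG : (a : 'rV_(1 + m)) *m (A *m G) = row_mx (a1 + a2 *m c) (a2 *m A').
  by rewrite AG {1}aE mul_row_block !mulmx0 mulmx1 add0r.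
have bHG : b *m (row_mx 0 D' *m H) *m G = row_mx 0 (b *m D').
  by rewrite -!mulmxA HG mulmx1 mul_mx_row mulmx0.
move=> ab0; have := congr1 (fun u : 'rV_(1 + n) => u *m G) ab0 => /=.
rewrite mulmxDl [b *m _ *m G]bHG -[a *m A *m G]mulmxA [a *m (A *m G)]aAG mul0mx.
rewrite [_ + _]add_row_mx addr0 => /eqP.
rewrite row_mx_eq0 => /andP[/eqP dE /eqP abE].
have /eqP : row_mx a2 b = 0 by apply: (row_indepP _ D'_ind); rewrite mul_row_col.
rewrite row_mx_eq0 => /andP[/eqP a2_0 /eqP ->].
by move: dE; rewrite aE a2_0 mul0mx addr0 => ->; rewrite !row_mx0.
Qed.

End FiniteRing.

(** * Row spans, their bases, and their intersection with [Espace] *)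

Section Subspaces.
Variable R : finComNzRingType.

Lemma row_span_subP (m p N : nat) (A : 'M[R]_(m, N)) (B : 'M[R]_(p, N)) :
  reflect (exists C, B = C *m A) (row_span B \subset row_span A).
Proof.
apply: (iffP subsetP) => [sBA | [C ->] _ /imsetP[c _ ->]]; last first.
  by rewrite mulmxA; apply: imset_f.
have rowB i : exists c, row i B == c *m A.
  have /imsetP[c _ cA] : row i B \in row_span A by apply: sBA; rewrite rowE; apply: imset_f.
  by exists c; rewrite -cA.
exists (\matrix_i xchoose (rowB i)); apply/row_matrixP => i.
by rewrite row_mul rowK; apply/eqP/(xchooseP (rowB i)).
Qed.

Lemma card_row_span (m N : nat) (A : 'M[R]_(m, N)) :
  row_indep A -> #|row_span A| = (#|R| ^ m)%N.
Proof.
by move=> A_ind; rewrite card_imset ?card_mx ?mul1n // => c d; apply: mulmx_lcancel.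
Qed.

(** The smaller span has [#|R| ^ p] elements, at least the [#|R| ^ m] of the larger one. *)
Lemma row_span_eq (m p N : nat) (A : 'M[R]_(m, N)) (B : 'M[R]_(p, N)) :
  row_indep A -> row_indep B -> (m <= p)%N ->
  row_span B \subset row_span A -> row_span B = row_span A.
Proof.
move=> A_ind B_ind le_mp sBA; apply/eqP; rewrite eqEcard sBA !card_row_span //.
by rewrite leq_exp2l // card_finNzRing_gt1.
Qed.

Lemma row_span_col_mx (m p q N : nat) (A : 'M[R]_(m, N)) (B : 'M[R]_(p, N)) (C : 'M[R]_(q, N)) :
  (row_span (col_mx B C) \subset row_span A) =
  (row_span B \subset row_span A) && (row_span C \subset row_span A).
Proof.
apply/row_span_subP/andP => [[D DE] | [/row_span_subP[D ->] /row_span_subP[E ->]]].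
  rewrite -[D]vsubmxK mul_col_mx in DE; have [-> ->] := eq_col_mx DE.
  by split; apply/row_span_subP; [exists (usubmx D) | exists (dsubmx D)].
by exists (col_mx D E); rewrite mul_col_mx.
Qed.

Lemma subspaceP (m N : nat) (P : {set 'rV[R]_N}) :
  reflect (exists2 A : 'M[R]_(m, N), row_indep A & P = row_span A) (subspace m P).
Proof.
apply: (iffP andP) => [[_ /existsP[A]] | [A A_ind ->]].
  by case/andP => /andP[/eqP -> A_ind] _; exists A.
split; last by apply/existsP; exists A; rewrite /basis_of_rows eqxx A_ind -row_indep_unimodular.
apply/submoduleP; split; first by apply/imsetP; exists 0; rewrite ?mul0mx.
move=> a _ _ /imsetP[c _ ->] /imsetP[d _ ->].
by rewrite scalemxAl -mulmxDl; apply: imset_f.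
Qed.

Lemma row_span_leq (m p N : nat) (A : 'M[R]_(m, N)) (B : 'M[R]_(p, N)) :
  row_indep A -> row_indep B -> row_span B \subset row_span A -> (p <= m)%N.
Proof.
move=> A_ind B_ind /subset_leq_card; rewrite !card_row_span //.
by rewrite leq_exp2l // card_finNzRing_gt1.
Qed.

(** With [B = C *m A] the coefficient matrix [C] is independent; completing it by [D] to a square
    matrix makes [D *m A] the missing basis vectors. *)
Lemma basis_extend (m p r N : nat) (A : 'M[R]_(m, N)) (B : 'M[R]_(p, N)) :
  row_indep A -> row_indep B -> row_span B \subset row_span A -> m = (p + r)%N ->
  exists2 D : 'M[R]_(r, N), row_indep (col_mx B D) & row_span (col_mx B D) = row_span A.
Proof.
move=> A_ind B_ind /row_span_subP[C BE] mE; move: A A_ind C BE; rewrite {}mE => A A_ind C BE.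
have C_ind : row_indep C by rewrite -(row_indep_mulmx C A_ind) -BE.
have [D CD_ind] := row_indep_complete erefl C_ind.
have CDE : col_mx B (D *m A) = col_mx C D *m A by rewrite mul_col_mx -BE.
have CDA : row_indep (col_mx B (D *m A)) by rewrite CDE row_indep_mulmx.
exists (D *m A) => //; apply: row_span_eq; rewrite ?leqnn //.
by apply/row_span_subP; exists (col_mx C D).
Qed.

Lemma row_indep_row_mx0 (m n k : nat) (T : 'M[R]_(m, k)) :
  row_indep (row_mx (0 : 'M_(m, n)) T) = row_indep T.
Proof.
apply/row_indepP/row_indepP => T_ind c cT; apply: T_ind.
  by rewrite mul_mx_row mulmx0 cT row_mx0.
by move: cT; rewrite mul_mx_row => /eqP; rewrite row_mx_eq0 => /andP[_ /eqP].
Qed.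

Lemma row_indep_block (s t n k : nat) (S : 'M[R]_(s, n)) (X : 'M[R]_(s, k)) (T : 'M[R]_(t, k)) :
  row_indep S -> row_indep T -> row_indep (block_mx S X 0 T).
Proof.
move=> /row_indepP S_ind /row_indepP T_ind; apply/row_indepP => c.
rewrite -[c]hsubmxK mul_row_block mulmx0 addr0 => /eqP; rewrite row_mx_eq0.
case/andP => /eqP/S_ind -> /eqP; rewrite mul0mx add0r => /T_ind ->.
by rewrite row_mx0.
Qed.

Lemma mem_Espace (n k : nat) (v : 'rV[R]_(n + k)) : (v \in Espace R n k) = (lsubmx v == 0).
Proof.
rewrite /Espace.
have -> : \matrix_(i < k) delta_mx 0 (rshift n i) = row_mx 0 1%:M :> 'M[R]_(k, n + k).
  apply/matrixP => i j; rewrite !mxE eqxx /=; case: splitP => j' jj'.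
    by rewrite mxE -val_eqE /= jj'; case: eqP => // ji; have := ltn_ord j'; lia.
  by rewrite mxE -val_eqE /= jj' eqn_add2l eq_sym.
apply/imsetP/eqP => [[c _ ->] | v0].
  by rewrite mul_mx_row row_mxKl mulmx0.
by exists (rsubmx v) => //; rewrite mul_mx_row mulmx0 mulmx1 -v0 hsubmxK.
Qed.

(** A combination whose left part vanishes has zero coefficients on the rows of [S], as these are
    independent. *)
Lemma row_span_block_cap (s t n k : nat) (S : 'M[R]_(s, n)) (X : 'M[R]_(s, k)) (T : 'M[R]_(t, k)) :
  row_indep S -> row_span (block_mx S X 0 T) :&: Espace R n k = row_span (row_mx 0 T).
Proof.
move=> /row_indepP S_ind; apply/setP => v; rewrite inE mem_Espace.
apply/andP/imsetP => [[/imsetP[c _ ->]] | [c _ ->]].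
  rewrite -[c]hsubmxK mul_row_block mulmx0 addr0 row_mxKl => /eqP/S_ind ->.
  by exists (rsubmx c); rewrite // !mul0mx add0r mul_mx_row mulmx0.
rewrite mul_mx_row row_mxKl mulmx0 eqxx; split=> //; apply/imsetP.
by exists (row_mx 0 c); rewrite // mul_row_block !mul0mx mulmx0 !add0r.
Qed.

Lemma mt_subspace_block (s t n k : nat) (S : 'M[R]_(s, n)) (X : 'M[R]_(s, k)) (T : 'M[R]_(t, k)) :
  row_indep S -> row_indep T -> mt_subspace (s + t) t (row_span (block_mx S X 0 T)).
Proof.
move=> S_ind T_ind; rewrite /mt_subspace row_span_block_cap //; apply/andP; split; apply/subspaceP.
  by exists (block_mx S X 0 T) => //; apply: row_indep_block.
by exists (row_mx 0 T); rewrite // row_indep_row_mx0.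
Qed.

(** The basis [T1] is extended first to a basis of [Q :&: Espace R n k], then, together with the
    rows of [S1] and [X1], to a basis of [Q]. The rows added last supply [S'] and [X']. *)
Lemma mt_subspace_frame (n k s1 t1 m t : nat) (S1 : 'M[R]_(s1, n)) (X1 : 'M[R]_(s1, k))
    (T1 : 'M[R]_(t1, k)) (Q : {set 'rV[R]_(n + k)}) :
  row_indep S1 -> row_indep T1 -> mt_subspace m t Q ->
  row_span (block_mx S1 X1 0 T1) \subset Q ->
  exists s' t', [/\ t = (t1 + t')%N, m = (s1 + s' + (t1 + t'))%N &
    exists (S' : 'M_(s', n)) (X' : 'M_(s', k)) (T' : 'M_(t', k)),
    [/\ row_indep (col_mx S1 S'), row_indep (col_mx T1 T') &
        Q = row_span (block_mx (col_mx S1 S') (col_mx X1 X') 0 (col_mx T1 T'))]].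
Proof.
move=> S1_ind T1_ind /andP[/subspaceP[A A_ind QE] /subspaceP[B B_ind QEE]] sPQ.
have sT1B : row_span (row_mx 0 T1) \subset row_span B.
  by rewrite -QEE -(row_span_block_cap X1 T1 S1_ind) setSI.
have T1'_ind : row_indep (row_mx (0 : 'M_(t1, n)) T1) by rewrite row_indep_row_mx0.
have le_t1 := row_span_leq B_ind T1'_ind sT1B.
have [T' T_ind TE] := basis_extend B_ind T1'_ind sT1B (esym (subnKC le_t1)).
(* The added rows lie in [Espace], so their left parts vanish. *)
have T'E : T' = row_mx 0 (rsubmx T').
  rewrite -[LHS]hsubmxK; congr row_mx; apply/row_matrixP => i; rewrite row0.
  have : row i T' \in Q :&: Espace R n k.
    rewrite QEE -TE; apply/imsetP; exists (row_mx 0 (delta_mx 0 i)) => //.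
    by rewrite mul_row_col mul0mx add0r rowE.
  by rewrite inE mem_Espace => /andP[_ /eqP]; rewrite !rowE -mulmx_lsub.
have Tcol : col_mx (row_mx 0 T1) T' = row_mx (0 : 'M_(_, n)) (col_mx T1 (rsubmx T')).
  by rewrite {1}T'E -block_mxEv block_mxEh col_mx0.
move: T_ind TE; rewrite {}Tcol row_indep_row_mx0 -QEE.
move: (rsubmx T') => {T'E}T'; set T := col_mx _ _ => T_ind TE.
have sPA : row_span (block_mx S1 X1 0 T) \subset row_span A.
  rewrite block_mxEv row_span_col_mx TE -QE subsetIl andbT; apply: subset_trans sPQ.
  apply/row_span_subP; exists (row_mx 1%:M 0).
  by rewrite block_mxEv mul_row_col mul1mx mul0mx addr0.
have P_ind := row_indep_block X1 S1_ind T_ind.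
have le_m := row_span_leq A_ind P_ind sPA.
have [D D_ind DE] := basis_extend A_ind P_ind sPA (esym (subnKC le_m)).
set r := (m - _)%N in D D_ind DE; exists r, (t - t1)%N; split.
- by rewrite subnKC.
- by rewrite /r; lia.
exists (lsubmx D), (rsubmx D), T'; have S_ind : row_indep (col_mx S1 (lsubmx D)).
  apply/row_indepP => c cS.
  (* A relation [c] between the left parts gives a vector of [Q] inside [Espace], hence a
     combination [d] of the rows of [T]. Independence of the whole basis of [Q] then forces
     [c = 0]. *)
  have : c *m col_mx (row_mx S1 X1) D \in row_span (row_mx 0 T).
    rewrite TE inE mem_Espace -mulmx_lsub -{2}[D]hsubmxK -block_mxEv block_mxEh row_mxKl cS eqxx.
    rewrite andbT QE -DE; apply/imsetP; exists (row_mx (row_mx (lsubmx c) 0) (rsubmx c)) => //.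
    rewrite block_mxEv mul_row_col [row_mx (lsubmx c) _ *m _]mul_row_col mul0mx addr0.
    by rewrite -[c in LHS]hsubmxK mul_row_col.
  case/imsetP => d _; rewrite -[c in LHS]hsubmxK mul_row_col => cd.
  have /eqP : row_mx (row_mx (lsubmx c) (- d)) (rsubmx c) = 0.
    apply: (row_indepP _ D_ind).
    rewrite block_mxEv mul_row_col [row_mx (lsubmx c) _ *m _]mul_row_col.
    by rewrite addrAC cd mulNmx subrr.
  rewrite !row_mx_eq0 => /andP[/andP[/eqP c1 _] /eqP c2].
  by rewrite -[c]hsubmxK c1 c2 row_mx0.
split=> //; symmetry; rewrite QE; apply: row_span_eq => //; first exact: row_indep_block.
  by rewrite /r; lia.
(* The last block has the same rows as [col_mx (block_mx S1 X1 0 T) D] in another order. *)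
rewrite block_mxEv row_span_col_mx TE -QE subsetIl andbT -block_mxEh block_mxEv hsubmxK.
rewrite {1}QE row_span_col_mx -DE.
move: (subxx (row_span (col_mx (block_mx S1 X1 0 T) D))).
by rewrite block_mxEv !row_span_col_mx -andbA => /and3P[-> _ ->].
Qed.

(** * Numbers of matrices with independent rows *)

Definition num_indep (c b : nat) : nat := #|[set A : 'M[R]_(c, b) | row_indep A]|.

Lemma row_indep_lower_block (a c r : nat) (Y1 : 'M[R]_(c, a)) (Y2 : 'M[R]_(c, r)) :
  row_indep (block_mx 1%:M 0 Y1 Y2) = row_indep Y2.
Proof.
apply/row_indepP/row_indepP => Y_ind c' cY.
  have /eqP : row_mx (- (c' *m Y1)) c' = 0.
    by apply: Y_ind; rewrite mul_row_block mulmx1 mulmx0 addNr add0r cY row_mx0.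
  by rewrite row_mx_eq0 => /andP[_ /eqP].
move: cY; rewrite -[c']hsubmxK mul_row_block mulmx1 mulmx0 add0r => /eqP.
rewrite row_mx_eq0 => /andP[c1 /eqP/Y_ind c2].
by move: c1; rewrite c2 mul0mx addr0 => /eqP ->; rewrite row_mx0.
Qed.

(** Complete [A] to an invertible [G]. In coordinates over the rows of [G] the new rows are a pair
    [Y1], [Y2], where [Y1] is arbitrary and only [Y2] has to be independent. *)
Lemma card_row_indep_extend (a b c r : nat) (A : 'M[R]_(a, b)) : b = (a + r)%N -> row_indep A ->
  #|[set D : 'M[R]_(c, b) | row_indep (col_mx A D)]| = (#|R| ^ (c * a) * num_indep c r)%N.
Proof.
move=> bE; move: A; rewrite {b}bE => A A_ind.
have [D G_ind] := row_indep_complete erefl A_ind; set G := col_mx A D in G_ind.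
have /existsP[H /eqP GH] : unimodular G by rewrite -row_indep_unimodular.
pose f (Y : 'M[R]_(c, a) * 'M[R]_(c, r)) := row_mx Y.1 Y.2 *m G.
have fE Y : col_mx A (f Y) = block_mx 1%:M 0 Y.1 Y.2 *m G.
  by rewrite block_mxEv mul_col_mx mul_row_col mul1mx mul0mx addr0.
have -> : [set D : 'M[R]_(c, a + r) | row_indep (col_mx A D)] =
    f @: setX setT [set Y | row_indep Y].
  apply/setP => E; rewrite inE; apply/idP/imsetP => [E_ind | [Y]]; last first.
    by rewrite !inE /= => Y_ind ->; rewrite fE row_indep_mulmx // row_indep_lower_block.
  have EE : E = f (lsubmx (E *m H), rsubmx (E *m H)).
    by rewrite /f hsubmxK -mulmxA (mulmx1C GH) mulmx1.
  exists (lsubmx (E *m H), rsubmx (E *m H)) => //; rewrite !inE /=.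
  by move: E_ind; rewrite {1}EE fE row_indep_mulmx // row_indep_lower_block.
rewrite card_imset; first by rewrite cardsX cardsT card_mx.
by move=> [Y1 Y2] [Z1 Z2] /(mulmx_lcancel G_ind)/eq_row_mx[/= -> ->].
Qed.

Lemma num_indep0 (b : nat) : num_indep 0 b = 1%N.
Proof.
rewrite /num_indep -(cards1 (0 : 'M[R]_(0, b))); congr #|pred_of_set _|.
by apply/setP => A; rewrite !inE [A]flatmx0 eqxx row_indep0.
Qed.

Lemma num_indepS0 (c : nat) : num_indep c.+1 0 = 0%N.
Proof.
apply/eqP; rewrite cards_eq0; apply/set0Pn => -[A]; rewrite inE.
by move/row_indep_leq.
Qed.

(** Matrices are sorted by their first row; each independent first row has the same number of
    extensions. *)
Lemma num_indepS (c b : nat) :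
  num_indep (1 + c) (1 + b) = (num_indep 1 (1 + b) * (#|R| ^ c * num_indep c b))%N.
Proof.
rewrite /num_indep -sum1_card (partition_big (@usubmx _ 1 c _)
  (fun v => v \in [set v | row_indep v])) /=.
  rewrite -sum_nat_const; apply: eq_bigr => v; rewrite inE => v_ind.
  rewrite -[c in (_ ^ c)%N]muln1 -(@card_row_indep_extend 1 (1 + b) c b v erefl v_ind).
  have inj : injective (@col_mx _ 1 c _ v) by move=> A B /eq_col_mx[].
  rewrite sum1dep_card -[RHS](card_imset _ inj).
  apply: eq_card => A; rewrite !inE.
  apply/andP/imsetP => [[A_ind /eqP Av] | [B]]; last by rewrite inE => B_ind ->; rewrite col_mxKu.
  by exists (dsubmx A); rewrite ?inE -Av vsubmxK.
move=> A; rewrite !inE -{1}[A]vsubmxK => /row_indepP A_ind; apply/row_indepP => c' cA.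
have /eqP : row_mx c' 0 = 0 :> 'rV_(1 + c) by apply: A_ind; rewrite mul_row_col cA mul0mx addr0.
by rewrite row_mx_eq0 => /andP[/eqP].
Qed.

(** The exponents [0, ..., c - 1] collected from [num_indepS] sum to ['C(c, 2)]. For [b < c] the
    factor [i = b] is [num_indep 1 0 = 0], so the truncated [b - i] is harmless. *)
Lemma num_indepE (c b : nat) :
  num_indep c b = (#|R| ^ 'C(c, 2) * \prod_(i < c) num_indep 1 (b - i))%N.
Proof.
elim: c b => [|c IHc] b; first by rewrite num_indep0 big_ord0.
rewrite big_ord_recl subn0; case: b => [|b]; first by rewrite !num_indepS0 mul0n muln0.
rewrite (num_indepS c b) IHc binS bin1 expnD; under [in RHS]eq_bigr do rewrite lift0 subSS.
by rewrite mulnCA !mulnA; congr (_ * _)%N; rewrite mulnC mulnA.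
Qed.

Lemma num_indep_gt0 (c r : nat) : (0 < num_indep c (c + r))%N.
Proof.
rewrite card_gt0; apply/set0Pn; exists (row_mx 1%:M 0).
by rewrite inE row_indep_row_mx1.
Qed.

End Subspaces.

(** * Counting the subspaces above [P] by frames *)

Section Frames.
Variables (R : finComNzRingType) (n k s1 t1 s' t' : nat).
Variables (S1 : 'M[R]_(s1, n)) (X1 : 'M[R]_(s1, k)) (T1 : 'M[R]_(t1, k)).
Hypotheses (S1_ind : row_indep S1) (T1_ind : row_indep T1).

(** The triple holds the blocks [S'], [X'], [T'] that are placed below the fixed [S1], [X1],
    [T1]. *)
Let frame : finType := ('M[R]_(s', n) * 'M[R]_(s', k) * 'M[R]_(t', k))%type.

Definition frame_mx (F : frame) : 'M[R]_(s1 + s' + (t1 + t'), n + k) :=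
  block_mx (col_mx S1 F.1.1) (col_mx X1 F.1.2) 0 (col_mx T1 F.2).

Definition frames : {set frame} :=
  setX (setX [set S | row_indep (col_mx S1 S)] setT) [set T | row_indep (col_mx T1 T)].

Lemma framesP (F : frame) :
  reflect (row_indep (col_mx S1 F.1.1) /\ row_indep (col_mx T1 F.2)) (F \in frames).
Proof. by rewrite !inE andbT; apply: andP. Qed.

Lemma frame_mx_indep (F : frame) : F \in frames -> row_indep (frame_mx F).
Proof. by case/framesP => S_ind T_ind; apply: row_indep_block. Qed.

Lemma sub_frame_span (F : frame) :
  row_span (block_mx S1 X1 0 T1) \subset row_span (frame_mx F).
Proof.
apply/row_span_subP; exists (block_mx (row_mx 1%:M 0) 0 0 (row_mx 1%:M 0)).
by rewrite mulmx_block !mul_row_col !mul0mx !mul1mx !mulmx0 !addr0 !add0r.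
Qed.

Lemma mt_subspaces_above_frames :
  mt_subspaces_above (s1 + s' + (t1 + t')) (t1 + t') (row_span (block_mx S1 X1 0 T1)) =
  [set row_span (frame_mx F) | F in frames].
Proof.
apply/setP => Q; rewrite inE; apply/andP/imsetP => [[mtQ sPQ] | [F /framesP[S_ind T_ind] ->]].
  have [s2 [t2 [tE mE [S' [X' [T' [S_ind T_ind ->]]]]]]] := mt_subspace_frame S1_ind T1_ind mtQ sPQ.
  (* Cancelling in the two size equations identifies [t2] with [t'] and [s2] with [s']. *)
  move: {tE}(addnI tE) mE S' X' T' S_ind T_ind => <- /addIn/addnI <- S' X' T' S_ind T_ind.
  by exists (S', X', T') => //; apply/framesP.
split; last exact: sub_frame_span.
exact: mt_subspace_block.
Qed.

Lemma card_frames :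
  #|frames| = (#|R| ^ (s' * s1) * num_indep R s' (n - s1) * #|R| ^ (s' * k) *
               (#|R| ^ (t' * t1) * num_indep R t' (k - t1)))%N.
Proof.
have nE := esym (subnKC (row_indep_leq S1_ind)); have kE := esym (subnKC (row_indep_leq T1_ind)).
by rewrite !cardsX cardsT card_mx (card_row_indep_extend _ nE) // (card_row_indep_extend _ kE).
Qed.

(** In coordinates over the rows of [col_mx A B] the fixed block [A] becomes [row_mx 1%:M 0]; this
    lets [card_row_indep_extend] count new rows inside a given span. *)
Lemma row_indep_relative (a c N : nat) (A : 'M[R]_(a, N)) (B : 'M[R]_(c, N))
    (D : 'M[R]_(c, a + c)) :
  row_indep (col_mx A B) ->
  row_indep (col_mx A (D *m col_mx A B)) = row_indep (col_mx (row_mx 1%:M 0) D).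
Proof.
move=> AB_ind; rewrite -[RHS](row_indep_mulmx _ AB_ind) mul_col_mx.
by rewrite [row_mx _ _ *m _]mul_row_col mul1mx mul0mx addr0.
Qed.

(* All frames of a given span are obtained from one of them, [F0], by the
   block-triangular substitutions [D], [Y], [C] below. *)
Lemma card_frame_fibre (F0 : frame) : F0 \in frames ->
  #|[set F in frames | row_span (frame_mx F) == row_span (frame_mx F0)]| =
  (#|R| ^ (s' * s1) * num_indep R s' s' * #|R| ^ (s' * (t1 + t')) *
   (#|R| ^ (t' * t1) * num_indep R t' t'))%N.
Proof.
case: F0 => [[S0 X0] T0] F0_in; have /framesP[/= S_ind T_ind] := F0_in.
set S := col_mx S1 S0 in S_ind; set T := col_mx T1 T0 in T_ind; set X := col_mx X1 X0.
pose f (Z : 'M[R]_(s', s1 + s') * 'M[R]_(s', t1 + t') * 'M[R]_(t', t1 + t')) : frame :=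
  (Z.1.1 *m S, Z.1.1 *m X + Z.1.2 *m T, Z.2 *m T).
pose W : {set 'M[R]_(s', s1 + s') * 'M[R]_(s', t1 + t') * 'M[R]_(t', t1 + t')} :=
  setX (setX [set D | row_indep (col_mx (row_mx 1%:M 0) D)] setT)
       [set C | row_indep (col_mx (row_mx 1%:M 0) C)].
have fW Z : (f Z \in frames) = (Z \in W) by rewrite !inE /= !row_indep_relative.
have -> : [set F in frames | row_span (frame_mx F) == row_span (frame_mx (S0, X0, T0))] = f @: W.
  apply/setP => F; rewrite inE; apply/andP/imsetP => [[F_in /eqP FE] | [Z ZW ->]]; last first.
    have fZ : f Z \in frames by rewrite fW.
    split=> //; apply/eqP/row_span_eq => //; try exact: frame_mx_indep.
    apply/row_span_subP; exists (block_mx (col_mx (row_mx 1%:M 0) Z.1.1) (col_mx 0 Z.1.2)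
                                          0 (col_mx (row_mx 1%:M 0) Z.2)).
    rewrite /frame_mx -/S -/X -/T mulmx_block !mulmx0 !mul0mx !addr0 add0r !mul_col_mx.
    rewrite [row_mx _ _ *m S]mul_row_col [row_mx _ _ *m X]mul_row_col [row_mx _ _ *m T]mul_row_col.
    by rewrite !mul1mx !mul0mx !addr0 add_col_mx addr0.
  have /row_span_subP[C] : row_span (frame_mx F) \subset row_span (frame_mx (S0, X0, T0)).
    by rewrite FE.
  rewrite -[C]submxK /frame_mx -/S -/X -/T mulmx_block !mulmx0 !addr0.
  move=> /eq_block_mx[SE XE /esym/eqP CS TE].
  (* The zero lower left block of [frame_mx F] and the independence of [S] make the transition
     matrix block triangular. *)
  have dl0 : dlsubmx C = 0.
    by apply: (mulmx_lcancel S_ind); rewrite mul0mx; apply/eqP.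
  rewrite dl0 mul0mx add0r in TE.
  have /eqP := SE; rewrite -[ulsubmx C]vsubmxK mul_col_mx => /eqP/eq_col_mx[_ SE'].
  have /eqP := XE; rewrite -[ulsubmx C]vsubmxK -[ursubmx C]vsubmxK !mul_col_mx add_col_mx.
  move=> /eqP/eq_col_mx[_ XE'].
  have /eqP := TE; rewrite -[drsubmx C]vsubmxK mul_col_mx => /eqP/eq_col_mx[_ TE'].
  have FfE : F = f (dsubmx (ulsubmx C), dsubmx (ursubmx C), dsubmx (drsubmx C)).
    by case: F SE' XE' TE' {F_in FE SE XE TE} => [[S' X'] T'] /= -> -> ->.
  by exists (dsubmx (ulsubmx C), dsubmx (ursubmx C), dsubmx (drsubmx C)); rewrite -?fW -?FfE.
rewrite card_imset.
  by rewrite !cardsX cardsT card_mx !(card_row_indep_extend _ erefl) ?row_indep_row_mx1.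
move=> [[D Y] C] [[D' Y'] C'] [/(mulmx_lcancel S_ind) <- + /(mulmx_lcancel T_ind) <-].
by move=> /addrI/(mulmx_lcancel T_ind) <-.
Qed.

(** All fibres of [F |-> row_span (frame_mx F)] have equal size, so the answer is the quotient of
    [card_frames] by [card_frame_fibre]. Of the powers of [#|R|] only [s' * k - s' * (t1 + t')]
    survives in the exponent. *)
Lemma card_mt_subspaces_above : (t1 + t' <= k)%N ->
  #|mt_subspaces_above (s1 + s' + (t1 + t')) (t1 + t') (row_span (block_mx S1 X1 0 T1))|%:R =
  #|R|%:R ^+ ((k - (t1 + t')) * s') *
  ((num_indep R s' (n - s1))%:R / (num_indep R s' s')%:R) *
  ((num_indep R t' (k - t1))%:R / (num_indep R t' t')%:R) :> rat.
Proof.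
move=> le_tk; rewrite mt_subspaces_above_frames; set above := imset _ _.
have R_gt0 : (0 < #|R|)%N by rewrite ltnW // card_finNzRing_gt1.
have count : #|frames| = (#|above| * (#|R| ^ (s' * s1) * num_indep R s' s' *
    #|R| ^ (s' * (t1 + t')) * (#|R| ^ (t' * t1) * num_indep R t' t')))%N.
  rewrite -sum1_card (partition_big_imset (fun F => row_span (frame_mx F))) /= -sum_nat_const.
  apply: eq_bigr => Q /imsetP[F0 F0_in ->]; rewrite -(card_frame_fibre F0_in) -sum1_card.
  by apply: eq_bigl => F; rewrite inE.
have num_neq0 c : (num_indep R c c)%:R != 0 :> rat.
  by rewrite pnatr_eq0 -lt0n -{2}[c]addn0 num_indep_gt0.
have Rneq0 : #|R|%:R != 0 :> rat by rewrite pnatr_eq0 -lt0n.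
have skE : (s' * k = s' * (t1 + t') + (k - (t1 + t')) * s')%N.
  by rewrite [(_ * s')%N]mulnC -mulnDr subnKC.
move: count; rewrite card_frames skE expnD => /(congr1 (fun x => x%:R : rat)).
rewrite !natrM !natrX => count.
(* Both sides are multiplied by the nonzero factors of the fibre size, which turns the claim into
   [count]. *)
apply/eqP; rewrite -(inj_eq (mulIf (num_neq0 s'))) -(inj_eq (mulIf (num_neq0 t'))).
have Rx i : #|R|%:R ^+ i != 0 :> rat by rewrite expf_neq0.
rewrite -(inj_eq (mulIf (Rx (s' * s1)%N))) -(inj_eq (mulIf (Rx (s' * (t1 + t'))%N))).
rewrite -(inj_eq (mulIf (Rx (t' * t1)%N))).
apply/eqP; transitivity (#|above|%:R * (#|R|%:R ^+ (s' * s1) * (num_indep R s' s')%:R *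
  #|R|%:R ^+ (s' * (t1 + t')) * (#|R|%:R ^+ (t' * t1) * (num_indep R t' t')%:R)) : rat).
  by ring.
by rewrite -count; field; rewrite !num_neq0.
Qed.

End Frames.

(** * Ideals and rows over a finite local ring *)

Section LocalRing.
Variables (A : finComNzRingType) (M : {set A}).
Hypothesis M_local : local_ring_with M.

Lemma local_idealr_closed : idealr_closed M.
Proof. by case: M_local => [[]]. Qed.

(** By finiteness [I] lies in an inclusion-maximal proper ideal, which is [M] by locality. The
    boolean [idb] restates [idealr_closed] so that [maxset] applies. *)
Lemma proper_ideal_sub_local (I : {set A}) : idealr_closed I -> I \subset M.
Proof.
pose idb (J : {set A}) := [&& 0 \in J, 1 \notin J &
  [forall a, forall u in J, forall v in J, a * u + v \in J]].
have idP (J : {set A}) : reflect (idealr_closed J) (idb J).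
  apply: (iffP and3P) => -[J0 J1 JM]; split=> //.
    move=> a u v Ju Jv; move/forallP/(_ a)/forall_inP/(_ u Ju): JM.
    by move/forall_inP; apply.
  by apply/forallP => a; apply/forall_inP => u Ju; apply/forall_inP => v; apply: JM.
move=> /idP/maxset_exists[J /maxsetP[/idP J_id J_max] sIJ].
suff <- : J = M by [].
by apply: M_local.2; split=> // K /idP K_id sJK; apply: J_max.
Qed.

(** If [r != 0], then [x] is a zero divisor, so the ideal of its multiples is proper and [x] lies in
    [M]. *)
Lemma local_regular (x r : A) : x \notin M -> r * x = 0 -> r = 0.
Proof.
move=> xM rx; apply/eqP; apply: contraNT xM => r_neq0.
have: [set x * y | y : A] \subset M.
  apply: proper_ideal_sub_local; split.
  - by apply/imsetP; exists 0; rewrite ?mulr0.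
  - apply/imsetP => -[y _ xy]; case/eqP: r_neq0.
    by rewrite -[r]mulr1 xy mulrA rx mul0r.
  - move=> a _ _ /imsetP[y _ ->] /imsetP[z _ ->].
    by rewrite mulrCA -mulrDr; apply: imset_f.
by move/subsetP; apply; apply/imsetP; exists 1; rewrite ?mulr1.
Qed.

Lemma card_local_rows (b : nat) :
  #|[set v : 'rV[A]_b | [exists i, v 0 i \notin M]]|%:R = #|A|%:R ^+ b - #|M|%:R ^+ b :> rat.
Proof.
have cardM : #|[set v : 'rV[A]_b | [forall i, v 0 i \in M]]| = (#|M| ^ b)%N.
  rewrite -[b in RHS]card_ord -card_ffun_on.
  pose f (v : 'rV[A]_b) := [ffun i => v 0 i].
  have f_inj : injective f.
    move=> u v /ffunP uv; apply/rowP => i.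
    by have := uv i; rewrite !ffunE.
  rewrite -(card_imset _ f_inj); apply: eq_card => g.
  apply/imsetP/ffun_onP => [[v] | gM].
    by rewrite inE => /forallP vM -> i; rewrite ffunE.
  exists (\row_i g i); last by apply/ffunP => i; rewrite ffunE mxE.
  by rewrite inE; apply/forallP => i; rewrite mxE.
apply/eqP; rewrite eq_sym subr_eq -!natrX -natrD eqr_nat -cardM.
have := cardsC [set v : 'rV[A]_b | [exists i, v 0 i \notin M]].
rewrite card_mx mul1n => <-; rewrite eqn_add2l; apply/eqP/eq_card => v.
by rewrite !inE negb_exists; apply/eq_forallb => i; rewrite negbK.
Qed.

End LocalRing.

(** * Independent rows and [NR] over a direct product of local rings *)

Section DirectProduct.
Variables (R : finComNzRingType) (l : nat) (Rj : 'I_l -> finComNzRingType).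
Variables (M : forall j, {set Rj j}) (pr : forall j, {rmorphism R -> Rj j}).
Hypothesis M_local : forall j, local_ring_with (M j).
Hypothesis pr_prod : is_direct_product pr.

Lemma pr_eq0 (r : R) : (forall j, pr j r = 0) -> r = 0.
Proof.
move=> r0; have [r' [_ uniq_r']] := pr_prod (fun=> 0).
by rewrite -(uniq_r' r r0); apply: uniq_r' => j; rewrite rmorph0.
Qed.

(** If all entries fell into [M j], then [v *m B = 1%:M] would put 1 there. Conversely an entry
    outside [M j] is regular in [Rj j], so every component of an annihilating coefficient
    vanishes. *)
Lemma row_indep_local (b : nat) (v : 'rV[R]_b) :
  row_indep v = [forall j, exists i, pr j (v 0 i) \notin M j].
Proof.
apply/idP/forallP => [|v_out].
  rewrite row_indep_unimodular => /existsP[B /eqP vB] j.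
  apply: contraT => /existsPn v_in.
  have [M0 /negP M1 MD] := local_idealr_closed (M_local j); case: M1.
  have -> : 1 = pr j ((v *m B) 0 0) by rewrite vB mxE rmorph1.
  rewrite mxE rmorph_sum /=; apply: (big_ind (fun x => x \in M j)) => // [x y Mx My | i _].
    by rewrite -[x]mul1r MD.
  by rewrite rmorphM mulrC -[_ * _]addr0 MD //; have := v_in i; rewrite negbK.
apply/row_indepP => c cv; rewrite [c]mx11_scalar.
suff -> : c 0 0 = 0 by rewrite raddf0.
apply: pr_eq0 => j; have /existsP[i vi] := v_out j.
apply: (local_regular (M_local j) vi); rewrite -rmorphM -[RHS](rmorph0 (pr j)); congr (pr j _).
by have /rowP/(_ i) := cv; rewrite [c]mx11_scalar mul_scalar_mx !mxE.
Qed.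

(** Applying all [pr j] entrywise is a bijection from the independent rows over [R] onto the
    families of rows with an entry outside each [M j]; surjectivity comes from lifting each entry
    separately. *)
Lemma num_indep1 (b : nat) :
  (num_indep R 1 b)%:R = \prod_(j < l) (#|Rj j|%:R ^+ b - #|M j|%:R ^+ b) :> rat.
Proof.
under eq_bigr do rewrite -card_local_rows.
rewrite -natr_prod -cardsXn; congr _%:R.
pose f (v : 'rV[R]_b) : {dffun forall j : 'I_l, 'rV[Rj j]_b} := [ffun j => map_mx (pr j) v].
have f_inj : injective f.
  move=> u v /ffunP uv; apply/rowP => i; apply/eqP; rewrite -subr_eq0; apply/eqP.
  apply: pr_eq0 => j; apply/eqP; rewrite rmorphB subr_eq0; apply/eqP.
  by have /rowP/(_ i) := uv j; rewrite !ffunE !mxE.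
rewrite /num_indep -(card_imset _ f_inj); apply: eq_card => g.
apply/imsetP/setXnP => [[v] | g_out].
  rewrite inE row_indep_local => /forallP v_out -> j; rewrite inE ffunE.
  by have /existsP[i vi] := v_out j; apply/existsP; exists i; rewrite mxE.
have lift i : exists r, [forall j, pr j r == g j 0 i].
  by have [r [rE _]] := pr_prod (fun j => g j 0 i); exists r; apply/forallP => j; rewrite rE.
have gE : g = f (\row_i xchoose (lift i)).
  apply/ffunP => j; rewrite ffunE; apply/rowP => i; rewrite !mxE.
  by apply/esym/eqP/(forallP (xchooseP (lift i))).
exists (\row_i xchoose (lift i)) => //; rewrite inE row_indep_local; apply/forallP => j.
have := g_out j; rewrite {1}gE inE ffunE => /existsP[i gi].
by apply/existsP; exists i; rewrite mxE in gi.
Qed.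

(** The powers of [#|R|] in [num_indepE] cancel in the quotient, and exchanging the two products
    gives the definition of [NR]. *)
Lemma NR_num_indep (a b : nat) : NR M a b = (num_indep R a b)%:R / (num_indep R a a)%:R.
Proof.
have R_neq0 : #|R|%:R ^+ 'C(a, 2) != 0 :> rat.
  by rewrite expf_neq0 // pnatr_eq0 -lt0n ltnW // card_finNzRing_gt1.
rewrite !num_indepE !natrM natrX -mulf_div divff // mul1r !natr_prod -prodf_div.
rewrite /NR exchange_big /=; apply: eq_bigr => i _.
by rewrite !num_indep1 -prodf_div.
Qed.

End DirectProduct.

(** * Size and non-emptiness in terms of [m1], [t1], [m] and [t] *)

Section Count.
Variable R : finComNzRingType.

(** This is [mt_subspace_frame] over the empty frame, whose span is zero. *)
Lemma mt_subspace_basis (n k m t : nat) (P : {set 'rV[R]_(n + k)}) : mt_subspace m t P ->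
  exists2 s, m = (s + t)%N & exists (S : 'M[R]_(s, n)) (X : 'M[R]_(s, k)) (T : 'M[R]_(t, k)),
    [/\ row_indep S, row_indep T & P = row_span (block_mx S X 0 T)].
Proof.
move=> mtP; have sub0 : row_span (block_mx 0 0 0 0 : 'M[R]_(0 + 0, n + k)) \subset P.
  have /andP[/subspaceP[A A_ind ->] _] := mtP.
  by apply/row_span_subP; exists 0; rewrite mul0mx block_mx0.
have [s [t' [-> -> [S [X [T [S_ind T_ind PE]]]]]]] :=
  mt_subspace_frame (row_indep0 _ n) (row_indep0 _ k) mtP sub0.
by exists (0 + s)%N => //; exists (col_mx 0 S), (col_mx 0 X), (col_mx 0 T).
Qed.

Lemma mt_subspaces_above_count (n k m1 t1 m t : nat) (P : {set 'rV[R]_(n + k)}) :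
  mt_subspace m1 t1 P -> (t1 <= t <= k)%N -> (m1 + t <= m + t1)%N ->
  #|mt_subspaces_above m t P|%:R =
  #|R|%:R ^+ ((k - t) * ((m - t) - (m1 - t1))) *
  ((num_indep R ((m - t) - (m1 - t1)) (n - (m1 - t1)))%:R /
   (num_indep R ((m - t) - (m1 - t1)) ((m - t) - (m1 - t1)))%:R) *
  ((num_indep R (t - t1) (k - t1))%:R / (num_indep R (t - t1) (t - t1))%:R) :> rat.
Proof.
case/mt_subspace_basis => s1 -> [S1 [X1 [T1 [S1_ind T1_ind ->]]]] /andP[le_t le_k] le_m.
have [s' ->] : exists s', m = (s1 + s' + t)%N by exists (m - t - s1)%N; lia.
have [t' tE] : exists t', t = (t1 + t')%N by exists (t - t1)%N; lia.
rewrite !addnK addKn tE addKn; apply: card_mt_subspaces_above => //.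
by rewrite -tE.
Qed.

(** The bounds by [n] and [k] come from the numbers of independent rows in a frame of a member.
    Conversely the counting formula is a product of nonzero factors. *)
Lemma mt_subspaces_above_neq0 (n k m1 t1 m t : nat) (P : {set 'rV[R]_(n + k)}) :
  mt_subspace m1 t1 P ->
  (mt_subspaces_above m t P != set0) =
  [&& t1 <= t, t <= k, t1 <= m1, t <= m, m1 + t <= m + t1 & m <= n + t]%N.
Proof.
move=> mtP; apply/set0Pn/idP => [[Q] | cond].
  have [s1 m1E [S1 [X1 [T1 [S1_ind T1_ind PE]]]]] := mt_subspace_basis mtP.
  rewrite inE PE => /andP[mtQ sPQ].
  have [s' [t' [tE mE [S' [X' [T' [S_ind T_ind _]]]]]]] := mt_subspace_frame S1_ind T1_ind mtQ sPQ.
  by have := row_indep_leq S_ind; have := row_indep_leq T_ind; lia.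
(* Writing the lengths as [s' + r] and [t' + q] brings the numerators into the form required by
   [num_indep_gt0]. *)
have [s' [t' [r [q [E1 E2 E3 E4]]]]] : exists s' t' r q, [/\ (m - t) - (m1 - t1) = s',
  t - t1 = t', n - (m1 - t1) = s' + r & k - t1 = t' + q]%N.
  exists (m - t - (m1 - t1))%N, (t - t1)%N, (n + t - m)%N, (k - t)%N; split; lia.
have := @mt_subspaces_above_count n k m1 t1 m t P mtP.
case: (set_0Vmem (mt_subspaces_above m t P)) => [-> | [Q Q_in] _]; last by exists Q.
rewrite cards0 => /(_ _ _) count.
have le1 : (t1 <= t <= k)%N by lia.
have le2 : (m1 + t <= m + t1)%N by lia.
move: (count le1 le2) => /esym/eqP; rewrite E1 E2 E3 E4 !mulf_eq0 expf_eq0 !invr_eq0 !pnatr_eq0.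
have R_gt0 : (0 < #|R|)%N by rewrite ltnW // card_finNzRing_gt1.
have sn c : num_indep R c c != 0%N by rewrite -lt0n -{2}[c]addn0 num_indep_gt0.
by rewrite !(negPf (sn _)) !eqn0Ngt !num_indep_gt0 R_gt0 andbF.
Qed.

(** For [n = 0] the left part is empty, so [Espace] is the whole space. *)
Lemma subspace_mt (a b : nat) (Q : {set 'rV[R]_b}) :
  subspace a Q = (@mt_subspace R 0 b a a Q).
Proof.
have E_top (v : 'rV[R]_(0 + b)) : v \in Espace R 0 b by rewrite mem_Espace; apply/eqP/thinmx0.
have QE : (Q : {set 'rV[R]_(0 + b)}) :&: Espace R 0 b = Q by apply/setIidPl/subsetP => v _.
by rewrite /mt_subspace QE andbb.
Qed.

End Count.

Theorem theorem5p3 (R : finComNzRingType) (l : nat)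
    (Rj : 'I_l -> finComNzRingType) (M : forall j, {set Rj j})
    (pr : forall j, {rmorphism R -> Rj j})
    (hlocal : forall j, local_ring_with (M j))
    (hprod : is_direct_product pr)
    (n k m1 t1 m t : nat) (P : {set 'rV[R]_(n + k)})
    (hP : mt_subspace m1 t1 P) :
  [/\ (mt_subspaces_above m t P != set0) <->
        ((0 <= t1%:Z /\ t1%:Z <= t%:Z /\ t%:Z <= k%:Z) /\
         (0 <= m1%:Z - t1%:Z /\ m1%:Z - t1%:Z <= m%:Z - t%:Z /\
          m%:Z - t%:Z <= n%:Z)),
      mt_subspaces_above m t P != set0 ->
        (forall P' : {set 'rV[R]_(n + k)}, mt_subspace m1 t1 P' ->
           #|mt_subspaces_above m t P'| = #|mt_subspaces_above m t P|) /\
        #|mt_subspaces_above m t P|%:R =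
          #|R|%:R ^+ ((k - t) * ((m - t) - (m1 - t1)))
          * NR M ((m - t) - (m1 - t1)) (n - (m1 - t1))
          * NR M (t - t1) (k - t1)
    & forall a b : nat,
        #|[set Q : {set 'rV[R]_b} | subspace a Q]|%:R = NR M a b].
Proof.
split; first by rewrite (mt_subspaces_above_neq0 _ _ hP); split; lia.
  rewrite (mt_subspaces_above_neq0 _ _ hP) => cond.
  have le_t : (t1 <= t <= k)%N by lia.
  have le_m : (m1 + t <= m + t1)%N by lia.
  split=> [P' hP'|]; last by rewrite !(NR_num_indep hlocal hprod); apply: mt_subspaces_above_count.
  (* The counting formula involves only the parameters, so it gives the same value for [P'] and
     [P]. *)
  by apply/eqP; rewrite -(eqr_nat rat) !(@mt_subspaces_above_count R n k m1 t1).
move=> a b; rewrite (NR_num_indep hlocal hprod); have [le_ab | lt_ba] := leqP a b; last first.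
  (* For [b < a] both sides vanish: no [a] rows of length [b] are independent. *)
  have -> : num_indep R a b = 0%N.
    apply/eqP; rewrite cards_eq0; apply/set0Pn => -[A]; rewrite inE => /row_indep_leq.
    by rewrite leqNgt lt_ba.
  rewrite mul0r; apply/eqP; rewrite pnatr_eq0 cards_eq0; apply/set0Pn => -[Q].
  by rewrite inE => /subspaceP[A /row_indep_leq]; rewrite leqNgt lt_ba.
(* With [n = 0], [P] zero and [m = t = a], the power of [#|R|] and the first quotient become 1, and
   every [a]-subspace lies above [P]. *)
have P0_mt : @mt_subspace R 0 b 0 0 (row_span (block_mx 0 0 0 0 : 'M_(0 + 0, 0 + b))).
  exact: (mt_subspace_block 0 (row_indep0 R 0) (row_indep0 R b)).
have le_m : (0 + a <= a + 0)%N by rewrite addn0.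
have := mt_subspaces_above_count P0_mt le_ab le_m.
rewrite !subnn !subn0 muln0 expr0 mul1r !num_indep0 divff ?oner_eq0 // mul1r.
move=> <-; congr _%:R; apply: eq_card => Q; rewrite !inE subspace_mt.
have [/andP[/subspaceP[A _ QE] _] | //] := boolP (@mt_subspace R 0 b a a Q).
rewrite block_mx0 QE /=; symmetry.
by apply/row_span_subP; exists 0; rewrite mul0mx.
Qed.
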